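(* Let $S$ be the space of all closed, non-empty, $\sigma$-invariant subsets $X\subset Q^{\mathbb{Z}}$, equipped with the Hausdorff metric, where $Q=[0,1]^{\mathbb{N}}$. Then there is a comeagre subset $\mathcal{G}\subset S$ such that for every $X\in\mathcal{G}$ the dynamical system $(X,T)=(X,\sigma|_X)$ has the following property: for every $m\in\mathbb{N}$, if $$\operatorname{mdim}(X)<\frac m2\quad\text{and}\quad \frac{\dim(\{x\in X:T^nx=x\})}{n}<\frac m2\ \text{ for all } n\ge1,$$ then there is an embedding from $(X,T)$ into $(([0,1]^m)^{\mathbb{Z}},\sigma)$. (That is, the Lindenstrauss--Tsukamoto conjecture for $\mathbb{Z}$-actions holds generically.)
   Context: $\mathbb{N}=\{1,2,\dots\}$. $Q=[0,1]^{\mathbb{N}}$ is the Hilbert cube and $Q^{\mathbb{Z}}$ carries the product topology, with a compatible metric $d$; $S$ carries the associated Hausdorff metric, in which it is compact. $\sigma$ denotes the shift $\sigma((x_n)_{n\in\mathbb{Z}})=(x_{n+1})_{n\in\mathbb{Z}}$, both on $Q^{\mathbb{Z}}$ and on $([0,1]^m)^{\mathbb{Z}}$; $X\subset Q^{\mathbb Z}$ is $\sigma$-invariant when $\sigma$ restricts to a homeomorphism of $X$. A set is comeagre if it is the complement of a countable union of nowhere dense sets. An embedding of $(X,T)$ into $(Z,R)$ is a continuous injective map $f:X\to Z$ with $f\circ T=R\circ f$. $\dim$ is Lebesgue covering dimension (with $\dim\emptyset=-1$). Mean dimension: for a compact metric space $(X,d)$ and $\epsilon>0$, $\operatorname{widim}_\epsilon(X,d)$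 is the smallest integer $n$ such that $X$ has a finite open cover $\mathcal{U}$ all of whose members have diameter at most $\epsilon$ and whose order $-1+\max_{x}\#\{U\in\mathcal{U}:x\in U\}$ is $n$. For a homeomorphism $T$ of $X$, with $d_{[n]}(x,y)=\max_{0\le i\le n-1}d(T^ix,T^iy)$, $$\operatorname{mdim}(X)=\sup_{\epsilon>0}\lim_{n\to\infty}\frac{\operatorname{widim}_\epsilon(X,d_{[n]})}{n}$$ (the limit exists). *)

(* Defs.v *)
From HB Require Import structures.
From mathcomp Require Import all_boot all_order all_algebra.
From mathcomp Require Import finmap lra.
From mathcomp Require Import all_classical all_reals all_analysis.
Set Implicit Arguments.
Unset Strict Implicit.
Unset Printing Implicit Defensive.
Import Order.TTheory GRing.Theory Num.Theory.
Import numFieldNormedType.Exports.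
Local Open Scope classical_set_scope.
Local Open Scope ring_scope.

Definition nowhere_dense (T : topologicalType) (A : set T) : Prop :=
  interior (closure A) = set0.

Definition comeagre (T : topologicalType) (G : set T) : Prop :=
  exists2 F : nat -> set T,
    (forall k, nowhere_dense (F k)) & G = ~` (\bigcup_k F k).

Definition homeomorphism (X Y : topologicalType) (f : X -> Y) : Prop :=
  continuous f /\
  exists2 g : Y -> X, continuous g & cancel f g /\ cancel g f.

Definition embedding (X Z : topologicalType) (T : X -> X) (S : Z -> Z)
    (f : X -> Z) : Prop :=
  [/\ continuous f, injective f & forall x, f (T x) = S (f x)].

(** Orders, dimensions and mean dimension take values in [\bar R], so that a
    minimum over an empty set of integers is [+oo]. *)

Definition finite_open_cover (X : topologicalType) (U : set (set X)) : Prop :=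
  [/\ finite_set U, (forall V, U V -> open V) & \bigcup_(V in U) V = setT].

(** The added value [0] only matters when [X] is empty: every cover of the
    empty space then has order [-1]. *)
Definition cover_order (R : realType) (X : topologicalType)
    (U : set (set X)) : \bar R :=
  (ereal_sup (0 |` [set (#|` fset_set [set V | U V /\ V x]|%fset%:R)%:E | x in setT])
   - 1)%E.

Definition refines (X : Type) (V U : set (set X)) : Prop :=
  forall B, V B -> exists2 A, U A & B `<=` A.

(** The index [n] ranges over [int]; as every cover has order at least [-1],
    this gives [-1] exactly for the empty space. *)
Definition covdim (R : realType) (X : topologicalType) : \bar R :=
  ereal_inf [set (n%:~R)%:E | n in [set n : int |
    forall U : set (set X), finite_open_cover U ->
      exists V : set (set X), [/\ finite_open_cover V, refines V U
        & (cover_order R V <= (n%:~R)%:E)%E]]].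

Definition widim (R : realType) (X : topologicalType) (rho : X -> X -> R)
    (e : R) : \bar R :=
  ereal_inf [set cover_order R U | U in [set U : set (set X) |
    finite_open_cover U /\
    forall V, U V -> forall x y, V x -> V y -> rho x y <= e]].

(** For [n > 0] the neutral value [0] is harmless, [rho] being nonnegative. *)
Definition bowen_dist (R : realType) (X : Type) (rho : X -> X -> R)
    (T : X -> X) (n : nat) (x y : X) : R :=
  \big[Num.max/0]_(i < n) rho (iter i T x) (iter i T y).

Definition mdim (R : realType) (X : topologicalType) (rho : X -> X -> R)
    (T : X -> X) : \bar R :=
  ereal_sup [set limn (fun n : nat =>
      (widim (bowen_dist rho T n) e / (n%:R)%:E)%E)
    | e in [set e : R | 0 < e]].

Definition unit_interval (R : realType) : pseudoMetricType R :=
  set_type (`[0, 1]%classic : set R).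

Definition cube (R : realType) (m : nat) : pseudoMetricType R :=
  {ptws 'I_m -> unit_interval R}.

(** Indexed by [nat] rather than by the positive integers. *)
Definition hilbert_cube (R : realType) : pseudoMetricType R :=
  {ptws nat -> unit_interval R}.

Definition biseq (R : realType) (K : pseudoMetricType R) : pseudoMetricType R :=
  {ptws int -> K}.

Definition bishift (R : realType) (K : pseudoMetricType R) (x : biseq K) :
    biseq K :=
  fun n : int => x (n + 1).

Record compatible_metric (R : realType) (X : topologicalType) :=
  CompatibleMetric {
    cdist :> X -> X -> R;
    cdistxx : forall x, cdist x x = 0;
    cdist_positivity : forall x y, cdist x y = 0 -> x = y;
    cdist_sym : forall x y, cdist x y = cdist y x;
    cdist_triangle : forall y x z, cdist x z <= cdist x y + cdist y z;
    cdist_nbhs : forall x (A : set X),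
      nbhs x A <-> exists2 e, 0 < e & forall y, cdist x y < e -> A y
  }.

Section Subshifts.
Variable R : realType.
Local Notation QZ := (biseq (hilbert_cube R)).

(** [shift_invariant X]: the shift restricts to a homeomorphism of [X], for the
    subspace topology carried by the subtype [X]. *)
Definition shift_invariant (X : set QZ) : Prop :=
  exists T : X -> X,
    (forall x, set_val (T x) = bishift (set_val x)) /\ homeomorphism T.

Definition subshifts : set (set QZ) :=
  [set X | [/\ closed X, X !=set0 & shift_invariant X]].

(** The metric [d] is a parameter of the type so that the Hausdorff metric
    below is inferred from it. *)
Definition subshift_space of compatible_metric R QZ : Type :=
  set_type subshifts.

HB.instance Definition _ (d : compatible_metric R QZ) :=
  Choice.on (subshift_space d).

Definition carrier (d : compatible_metric R QZ) (X : subshift_space d) :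
    set QZ :=
  set_val (X : set_type subshifts).

Section HausdorffMetric.
Variable d : compatible_metric R QZ.

Definition dist_set (x : QZ) (A : set QZ) : R := inf [set d x a | a in A].

Definition hausdorff_dist (A B : set QZ) : R :=
  Num.max (sup [set dist_set a B | a in A]) (sup [set dist_set b A | b in B]).

Lemma cdist_ge0 x y : 0 <= d x y.
Proof.
rewrite -(@pmulrn_lge0 _ _ 2)// -(cdistxx d x) mulr2n {2}(cdist_sym d x y).
exact: cdist_triangle.
Qed.

Lemma compact_unit_interval : compact [set: unit_interval R].
Proof.
move=> F FF _.
have FG : (set_val @ F) `[0, 1]%classic.
  by apply: (@filterS _ F _ setT); [move=> [x hx] _; exact: (set_mem hx)|exact: filterT].
have PG : ProperFilter (set_val @ F) by exact: fmap_proper_filter.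
have [x [x01 clx]] := @segment_compact R 0 1 _ PG FG.
exists (exist _ x (mem_set x01)); split=> // A B FA [_ [[V oV <-] Vx VB]].
have [||_ [[a Aa <-] Va]] := clx (set_val @` A) V.
- by apply: (@filterS _ F _ A _ _ FA) => a Aa; exists a.
- exact: open_nbhs_nbhs.
- by exists a; split=> //; exact: VB.
Qed.

Lemma compact_QZ : compact [set: QZ].
Proof.
have := @tychonoff int (fun=> hilbert_cube R) (fun=> setT).
have := @tychonoff nat (fun=> unit_interval R) (fun=> setT).
move=> /(_ (fun=> compact_unit_interval)).
have -> : [set f : nat -> unit_interval R | forall i, setT (f i)] = setT.
  by apply/seteqP; split.
move=> cQ /(_ (fun=> cQ)).
by have -> : [set f : int -> hilbert_cube R | forall i, setT (f i)] = setT
  by apply/seteqP; split.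
Qed.

Lemma cdist_continuous x : continuous (d x : QZ -> R).
Proof.
move=> y; apply/(@cvgrPdist_lt R R^o QZ _ (nbhs_filter y)) => e e0.
apply/(cdist_nbhs d y).
exists e => // z yz; rewrite ltr_norml; apply/andP; split.
  by have := cdist_triangle d y x z; lra.
have := cdist_triangle d z x y; rewrite (cdist_sym d z y); lra.
Qed.

Lemma cdist_bounded : exists M, forall x y, d x y <= M.
Proof.
have [[x0 _]|QZ0] := pselect (exists x : QZ, True); last first.
  by exists 0 => x; exfalso; apply: QZ0; exists x.
have /compact_bounded[M [_ HM]] : compact (d x0 @` setT).
  apply: continuous_compact compact_QZ.
  exact/continuous_subspaceT/cdist_continuous.
have dM x : d x0 x <= M + 1.
  have := HM (M + 1); rewrite ltrDl ltr01 => /(_ isT) /(_ (d x0 x)).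
  by move=> /(_ (imageT _ _)); exact/le_trans/ler_norm.
exists ((M + 1) + (M + 1)) => x y.
have := cdist_triangle d x0 x y; rewrite (cdist_sym d x x0).
have := dM x; have := dM y; lra.
Qed.

Lemma dist_set_le x A a : A a -> dist_set x A <= d x a.
Proof.
move=> Aa; apply: ge_inf; last by exists a.
by exists 0 => _ [b _ <-]; exact: cdist_ge0.
Qed.

Lemma le_dist_set x A r :
  A !=set0 -> (forall a, A a -> r <= d x a) -> r <= dist_set x A.
Proof.
move=> [a Aa] rA; apply: lb_le_inf; first by exists (d x a), a.
by move=> _ [b Ab <-]; exact: rA.
Qed.

Lemma dist_set_ge0 x A : A !=set0 -> 0 <= dist_set x A.
Proof. by move=> A0; apply: le_dist_set => // a _; exact: cdist_ge0. Qed.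

Lemma hausdorff_dist_sym A B : hausdorff_dist A B = hausdorff_dist B A.
Proof. by rewrite /hausdorff_dist maxC. Qed.

Lemma dist_set_le_hausdorff A B a :
  B !=set0 -> A a -> dist_set a B <= hausdorff_dist A B.
Proof.
move=> [b Bb] Aa; rewrite /hausdorff_dist le_max; apply/orP; left.
apply: ub_le_sup; last by exists a.
have [M dM] := cdist_bounded.
by exists M => _ [x _ <-]; exact: le_trans (dist_set_le _ Bb) (dM _ _).
Qed.

Lemma hausdorff_dist_le A B r : A !=set0 -> B !=set0 ->
  (forall a, A a -> dist_set a B <= r) ->
  (forall b, B b -> dist_set b A <= r) -> hausdorff_dist A B <= r.
Proof.
move=> [a Aa] [b Bb] AB BA; rewrite /hausdorff_dist ge_max; apply/andP; split.
- by apply: ge_sup => [|_ [x Ax <-]]; [exists (dist_set a B), a|exact: AB].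
- by apply: ge_sup => [|_ [x Ax <-]]; [exists (dist_set b A), b|exact: BA].
Qed.

Lemma hausdorff_dist_triangle B A C :
  A !=set0 -> B !=set0 -> C !=set0 ->
  hausdorff_dist A C <= hausdorff_dist A B + hausdorff_dist B C.
Proof.
move=> A0 B0 C0.
have half A' C' : A' !=set0 -> C' !=set0 -> forall a, A' a ->
    dist_set a C' <= hausdorff_dist A' B + hausdorff_dist B C'.
  move=> A'0 C'0 a A'a; rewrite -lerBlDr.
  apply: le_trans (dist_set_le_hausdorff B0 A'a).
  apply: le_dist_set => // b Bb; rewrite lerBlDr.
  apply: (@le_trans _ _ (d a b + dist_set b C')).
    rewrite -lerBlDl; apply: le_dist_set => // c C'c; rewrite lerBlDl.
    exact: le_trans (dist_set_le _ C'c) (cdist_triangle d _ _ _).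
  by rewrite lerD2l; exact: dist_set_le_hausdorff.
apply: hausdorff_dist_le => // [|c Cc]; first exact: half.
rewrite addrC (hausdorff_dist_sym B) (hausdorff_dist_sym A).
exact: half.
Qed.

Lemma hausdorff_distxx A : A !=set0 -> hausdorff_dist A A = 0.
Proof.
move=> A0; apply/eqP; rewrite eq_le; apply/andP; split.
  apply: hausdorff_dist_le => // a Aa;
  by rewrite -(cdistxx d a) dist_set_le.
have [a Aa] := A0.
exact: le_trans (dist_set_ge0 _ A0) (dist_set_le_hausdorff A0 Aa).
Qed.

Lemma hausdorff_dist_sub A B : A !=set0 -> B !=set0 -> closed B ->
  hausdorff_dist A B = 0 -> A `<=` B.
Proof.
move=> A0 B0 cB AB0 a Aa; apply: cB => N /(cdist_nbhs d a)[e e0 aN].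
apply: contrapT => BN; have : e <= dist_set a B.
  apply: le_dist_set => // b Bb; rewrite leNgt; apply/negP => /aN Nb.
  by apply: BN; exists b.
rewrite leNgt => /negP; apply; apply: le_lt_trans e0.
by rewrite -AB0; exact: dist_set_le_hausdorff.
Qed.

Lemma carrierP (X : subshift_space d) : subshifts (carrier X).
Proof. by case: X => X hX; exact: (set_mem hX). Qed.

Definition subshift_mdist (X Y : subshift_space d) : R :=
  hausdorff_dist (carrier X) (carrier Y).

Lemma subshift_mdistxx X : subshift_mdist X X = 0.
Proof. by have [_ X0 _] := carrierP X; exact: hausdorff_distxx. Qed.

Lemma subshift_mdist_positivity X Y : subshift_mdist X Y = 0 -> X = Y.
Proof.
move=> XY0; have [cX X0 _] := carrierP X; have [cY Y0 _] := carrierP Y.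
apply: val_inj; apply/seteqP; split; first exact: hausdorff_dist_sub XY0.
by apply: hausdorff_dist_sub => //; rewrite hausdorff_dist_sym.
Qed.

Lemma subshift_mdist_sym X Y : subshift_mdist X Y = subshift_mdist Y X.
Proof. exact: hausdorff_dist_sym. Qed.

Lemma subshift_mdist_triangle Y X Z :
  subshift_mdist X Z <= subshift_mdist X Y + subshift_mdist Y Z.
Proof.
have [_ X0 _] := carrierP X; have [_ Y0 _] := carrierP Y.
by have [_ Z0 _] := carrierP Z; exact: hausdorff_dist_triangle.
Qed.

HB.instance Definition _ := isMetric.Build R (subshift_space d)
  subshift_mdistxx subshift_mdist_positivity subshift_mdist_sym
  subshift_mdist_triangle.

Lemma carrier_shift_invariant (X : subshift_space d) :
  shift_invariant (carrier X).
Proof. by have [] := carrierP X. Qed.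

(** The restriction of [bishift] to [X]; it is unique because [set_val] is
    injective. *)
Definition restr_shift (X : subshift_space d) : carrier X -> carrier X :=
  sval (cid (carrier_shift_invariant X)).

Lemma restr_shiftE (X : subshift_space d) (x : carrier X) :
  set_val (restr_shift x) = bishift (set_val x).
Proof. by rewrite /restr_shift; case: cid => T [TE _] /=. Qed.

Lemma restr_shift_homeomorphism (X : subshift_space d) :
  homeomorphism (@restr_shift X).
Proof. by rewrite /restr_shift; case: cid => T []. Qed.

Definition restr_dist (X : subshift_space d) (x y : carrier X) : R :=
  d (set_val x) (set_val y).

End HausdorffMetric.
End Subshifts.

Definition periodic_points (X : Type) (T : X -> X) (n : nat) : set X :=
  [set x | iter n T x = x].

(* Main.v *)
Require Import Defs.
From HB Require Import structures.
From mathcomp Require Import all_boot all_order all_algebra.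
From mathcomp Require Import all_classical all_reals all_analysis.
From mathcomp Require Import lra.
Set Implicit Arguments.
Unset Strict Implicit.
Unset Printing Implicit Defensive.
Import Order.TTheory GRing.Theory Num.Theory.
Import numFieldNormedType.Exports.
Local Open Scope classical_set_scope.
Local Open Scope ring_scope.

(** The generic subshift is totally disconnected, and a totally disconnected
    system embeds in every cubical shift of positive dimension.

    For a coordinate [i] and rationals [p < q], consider the subshifts [X] for
    which some real level [r] of the interval from [p] to [q] is not attained by
    the [i]-th coordinate of the zeroth letter of any point of [X]
    ([misses_level]). Since [X] is compact this condition is open
    ([open_misses_level]). It is also dense ([misses_level_dense]): rounding all
    the entries of all the points of [X] down to multiples of a small [1 / M]
    commutes with the shift and moves every point little, uniformly over the
    compact space ([quantize_uniform]); the closure of the rounded set is then a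
    subshift close to [X] whose entries only take multiples of [1 / M]. There are
    countably many triples [(i, p, q)], so the subshifts satisfying all these
    conditions form a comeagre set.

    For such an [X], choose one missed level for each triple. A missed level
    cuts [X] into two clopen parts, hence a letter of a point of [X] is
    determined by a sequence of bits, telling on which side of each chosen level
    its coordinates lie, and these bits depend continuously on the point. Writing
    them as the ternary digits of a real number, as for the Cantor set
    ([ternary]), replaces each letter by one number of the unit interval. This
    code acts letter by letter, so that it commutes with the shift; it is
    injective because distinct reals are separated by a chosen level
    ([cut_code_embedding]). *)

(** * Ternary expansions with digits 0 and 2 *)

Section Ternary.
Variable R : realType.
Implicit Types b c : nat -> bool.

(** The [n]-th partial sum of the series of the [2 * b k / 3 ^ k.+1], in Horner
    form, which makes the self-similarity [ternary_rec] immediate. *)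
Fixpoint ternary_sum b (n : nat) : R :=
  if n is m.+1 then ((b 0).*2%:R + ternary_sum (b \o succn) m) / 3 else 0.

Definition ternary b : R := limn (ternary_sum b).

Lemma digit_cases (a : bool) : (a.*2%:R = (if a then 2 else 0) :> R).
Proof. by case: a. Qed.

Lemma ternary_sum01 b n : 0 <= ternary_sum b n <= 1.
Proof.
elim: n b => [|n IHn] b /=; first lra.
by have := IHn (b \o succn); rewrite digit_cases; case: (b 0%N); lra.
Qed.

Lemma ternary_sum_nondecreasing b : nondecreasing_seq (ternary_sum b).
Proof.
apply/nondecreasing_seqP => n; elim: n b => [|n IHn] b /=.
  by rewrite digit_cases; case: (b 0%N); lra.
by have /= := IHn (b \o succn); lra.
Qed.

Lemma cvgn_ternary_sum b : cvgn (ternary_sum b).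
Proof.
apply: nondecreasing_is_cvgn; first exact: ternary_sum_nondecreasing.
by exists 1 => _ [n _ <-]; have /andP[] := ternary_sum01 b n.
Qed.

Lemma ternary01 b : 0 <= ternary b <= 1.
Proof.
apply/andP; split.
  apply: limr_ge; first exact: cvgn_ternary_sum.
  by near=> n; have /andP[] := ternary_sum01 b n.
apply: limr_le; first exact: cvgn_ternary_sum.
by near=> n; have /andP[] := ternary_sum01 b n.
Unshelve. all: by end_near. Qed.

Lemma ternary_rec b : ternary b = ((b 0).*2%:R + ternary (b \o succn)) / 3.
Proof.
apply/cvg_lim => //; rewrite -cvg_shiftS /=.
apply: cvgMl; apply: cvgD; first exact: cvg_cst.
exact: cvgn_ternary_sum.
Qed.

(** A first digit 0 puts the value in the lower third of the unit interval and a
    first digit 2 in the upper third, so the value determines the first digit,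
    hence the value of the tail. *)
Lemma ternary_inj b c : ternary b = ternary c -> b =1 c.
Proof.
move=> + k; elim: k b c => [|k IHk] b c; rewrite (ternary_rec b) (ternary_rec c);
  have := ternary01 (b \o succn); have := ternary01 (c \o succn);
  rewrite !digit_cases => c01 b01 bc.
  by move: bc; case: (b 0%N); case: (c 0%N) => //; lra.
apply: (IHk (b \o succn) (c \o succn)).
by move: bc; case: (b 0%N); case: (c 0%N); lra.
Qed.

Lemma ternary_prefix n b c : (forall k, (k < n)%N -> b k = c k) ->
  `|ternary b - ternary c| <= 3^-1 ^+ n.
Proof.
elim: n b c => [|n IHn] b c bc.
  by have := ternary01 b; have := ternary01 c; rewrite expr0 ler_norml; lra.
rewrite (ternary_rec b) (ternary_rec c) (bc 0%N)// exprS.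
have := IHn (b \o succn) (c \o succn) (fun k kn => bc k.+1 kn).
by rewrite !ler_norml; lra.
Qed.

(** Continuity for the product topology on bit sequences, each bit being
    discrete. *)
Lemma cvg_ternary (T : Type) (F : set_system T) (FF : Filter F)
    (b : T -> nat -> bool) c :
  (forall k, \forall t \near F, b t k = c k) ->
  ternary (b t) @[t --> F] --> ternary c.
Proof.
move=> bc; apply/cvgrPdist_lt => e e0.
have [n ne] : exists n, 3^-1 ^+ n < e :> R.
  have /cvgrPdist_lt/(_ e e0)[n _ /(_ n (leqnn n))] : (3^-1 ^+ n : R) @[n --> \oo] --> 0.
    by apply: cvg_expr; rewrite ger0_norm ?invr_ge0// invf_lt1// ltr1n.
  by rewrite sub0r normrN ger0_norm ?exprn_ge0 ?invr_ge0//; exists n.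
have : \forall t \near F, forall k : 'I_n, b t k = c k by apply: filter_forall => k.
apply: filterS => t tn; apply: le_lt_trans ne.
by apply: ternary_prefix => k kn; rewrite (tn (Ordinal kn)).
Qed.

End Ternary.

(** * Convergence in spaces of arrays *)

Section Product.

Lemma cvg_initial (S : choiceType) (T : topologicalType) (f : S -> T)
    (F : set_system S) (s : S) :
  Filter F -> f @ F --> f s -> F --> (s : initial_topology f).
Proof.
move=> FF cvF A /= [_ [[B Bop <-] Bfs sBfA]].
by apply: filterS sBfA _; apply: cvF; exact: open_nbhs_nbhs.
Qed.

Lemma cvg_prod_topology (I : eqType) (K : I -> topologicalType)
    (F : set_system (prod_topology K)) (x : prod_topology K) :
  Filter F -> (forall i, proj i @ F --> x i) -> F --> x.
Proof.
by move=> FF cvF; apply/cvg_sup => i; apply: cvg_initial; exact: cvF.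
Qed.

Lemma cvg_hilbert_biseq (R : realType) (T : Type) (F : set_system T)
    (f : T -> biseq (hilbert_cube R)) (x : biseq (hilbert_cube R)) :
  Filter F ->
  (forall n i, (set_val (f t n i) : R) @[t --> F] --> (set_val (x n i) : R)) ->
  f @ F --> x.
Proof.
move=> FF fx; apply: cvg_prod_topology => n; apply: cvg_prod_topology => i.
by apply: cvg_initial; exact: fx.
Qed.

Lemma cvg_cube_biseq (R : realType) (m : nat) (T : Type) (F : set_system T)
    (f : T -> biseq (cube R m)) (x : biseq (cube R m)) :
  Filter F ->
  (forall n i, (set_val (f t n i) : R) @[t --> F] --> (set_val (x n i) : R)) ->
  f @ F --> x.
Proof.
move=> FF fx; apply: cvg_prod_topology => n; apply: cvg_prod_topology => i.
by apply: cvg_initial; exact: fx.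
Qed.

Definition entry (R : realType) (n : int) (i : nat)
    (x : biseq (hilbert_cube R)) : R := set_val (x n i).

Lemma continuous_entry (R : realType) n i : continuous (@entry R n i).
Proof.
move=> x.
apply: (@continuous_comp _ _ _ (proj n : biseq (hilbert_cube R) -> _)
  (set_val \o proj i : hilbert_cube R -> R)).
  exact: (@proj_continuous _ (fun=> hilbert_cube R) n).
apply: (@continuous_comp _ _ _ (proj i : hilbert_cube R -> _)
  (set_val : unit_interval R -> R)).
  exact: (@proj_continuous _ (fun=> unit_interval R) i).
exact: initial_continuous.
Qed.

End Product.

(** * Shift-invariant sets *)

Section Shift.
Variable R : realType.
Local Notation QZ := (biseq (hilbert_cube R)).

Lemma entry01 n i (x : QZ) : 0 <= entry n i x <= 1.
Proof. by have /set_mem := valP (x n i); rewrite /= in_itv. Qed.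

Lemma entry_ext (x y : QZ) : (forall n i, entry n i x = entry n i y) -> x = y.
Proof. by move=> xy; apply/funext => n; apply/funext => i; exact/val_inj/xy. Qed.

Definition unshift (x : QZ) : QZ := fun n => x (n - 1).

Lemma bishiftK : cancel (@bishift R (hilbert_cube R)) unshift.
Proof. by move=> x; apply/funext => n; rewrite /unshift /bishift subrK. Qed.

Lemma unshiftK : cancel unshift (@bishift R (hilbert_cube R)).
Proof. by move=> x; apply/funext => n; rewrite /unshift /bishift addrK. Qed.

Lemma reindex_continuous (g : int -> int) :
  continuous ((fun x n => x (g n)) : QZ -> QZ).
Proof.
move=> x; apply: (cvg_hilbert_biseq (nbhs_filter x)) => n i.
exact: continuous_entry.
Qed.

Lemma bishift_continuous : continuous (@bishift R (hilbert_cube R)).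
Proof. exact: (reindex_continuous (g := fun n => n + 1)). Qed.

Lemma unshift_continuous : continuous unshift.
Proof. exact: (reindex_continuous (g := fun n => n - 1)). Qed.

(** Reduces invariance, which is about a homeomorphism of the subtype, to two
    inclusions of sets: the shift is a homeomorphism of the whole space. *)
Lemma shift_invariantP (X : set QZ) : shift_invariant X <->
  (forall x, X x -> X (bishift x)) /\ (forall x, X x -> X (unshift x)).
Proof.
split=> [[T [TE [_ [S _ [_ SK]]]]]|[Xs Xu]].
  split=> x Xx; pose x' : X := exist _ x (mem_set Xx).
    have <- : set_val (T x') = bishift x := TE x'.
    exact: set_mem (valP (T x')).
  have <- : set_val (S x') = unshift x by rewrite -[LHS]bishiftK -TE SK.
  exact: set_mem (valP (S x')).
pose T (x : X) : X := exist _ (bishift (set_val x)) (mem_set (Xs _ (set_mem (valP x)))).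
pose S (x : X) : X := exist _ (unshift (set_val x)) (mem_set (Xu _ (set_mem (valP x)))).
exists T; split=> //; split.
  move=> x; apply: (cvg_initial (fmap_filter _ (nbhs_filter x))) => /=.
  apply: (@continuous_comp _ _ _ (set_val : X -> QZ) (@bishift R _)).
    exact: initial_continuous.
  exact: bishift_continuous.
exists S.
  move=> x; apply: (cvg_initial (fmap_filter _ (nbhs_filter x))) => /=.
  apply: (@continuous_comp _ _ _ (set_val : X -> QZ) unshift).
    exact: initial_continuous.
  exact: unshift_continuous.
by split=> x; apply: val_inj => /=; rewrite ?bishiftK ?unshiftK.
Qed.

(** The entries of index [n] of points of an invariant set are already entries of
    index [0] of such points, so conditions on letters need only be imposed at
    index [0]. *)
Lemma shift_invariant_entry (X : set QZ) : shift_invariant X ->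
  forall n x, X x -> exists2 y, X y & forall i, entry n i x = entry 0 i y.
Proof.
move=> /shift_invariantP[Xs Xu]; elim/int_ind => [|n IHn|n IHn] x Xx.
- by exists x.
- have [y Xy xy] := IHn _ (Xs _ Xx); exists y => // i; rewrite -xy.
  by rewrite /entry /bishift intS addrC.
- have [y Xy xy] := IHn _ (Xu _ Xx); exists y => // i; rewrite -xy.
  by rewrite /entry /unshift intS opprD addrC.
Qed.

Lemma shift_invariant_closure (X : set QZ) :
  shift_invariant X -> shift_invariant (closure X).
Proof.
move=> /shift_invariantP[Xs Xu]; apply/shift_invariantP.
have cl (f : QZ -> QZ) : continuous f -> (forall x, X x -> X (f x)) ->
    forall x, closure X x -> closure X (f x).
  move=> cf Xf x Xx A /cf/Xx[y [Xy Ay]]; exists (f y); split=> //; exact: Xf.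
by split; apply: cl => //; [exact: bishift_continuous|exact: unshift_continuous].
Qed.

End Shift.

(** * Rounding the entries *)

Section Quantize.
Variable R : realType.
Local Notation QZ := (biseq (hilbert_cube R)).

Definition round_down (M : nat) (t : R) : R := (Num.floor (M.+1%:R * t))%:~R / M.+1%:R.

Lemma round_down_le M t : t - M.+1%:R^-1 <= round_down M t <= t.
Proof.
rewrite /round_down.
rewrite ler_pdivlMr ?ltr0n// ler_pdivrMr ?ltr0n//.
rewrite mulrBl mulVf ?pnatr_eq0// !(mulrC t).
have := Num.Theory.floor_le (M.+1%:R * t).
have := Num.Theory.floorD1_gt (M.+1%:R * t).
rewrite intrD; lra.
Qed.

Lemma round_down01 M (t : unit_interval R) : round_down M (set_val t) \in `[0, 1]%classic.
Proof.
apply/mem_set; rewrite /= in_itv /=; have /set_mem := valP t; rewrite /= in_itv /= => /andP[t0 t1].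
have /andP[_ rt] := round_down_le M (set_val t); rewrite (le_trans rt t1) andbT.
by rewrite divr_ge0// ler0z floor_ge0 mulr_ge0.
Qed.

Definition quantize (M : nat) (x : QZ) : QZ :=
  fun n i => exist (fun t => t \in `[0, 1]%classic) _ (round_down01 M (x n i)).

Lemma entry_quantize M n i x : entry n i (quantize M x) = round_down M (entry n i x).
Proof. by []. Qed.

(** Joint convergence in the point and in the precision is what the compactness
    argument of [quantize_uniform] requires. In a product it is checked entry by
    entry, where it is a squeeze. *)
Lemma quantize_cvg (x : QZ) :
  (quantize y.2 y.1) @[y --> (x, \oo)] --> x.
Proof.
apply: cvg_hilbert_biseq => n i.
rewrite -/(entry n i x).
have c1 : (fun y : QZ * nat => entry n i y.1) @ (nbhs x, \oo) --> entry n i x.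
  apply: (@cvg_comp _ _ _ (@fst QZ nat) (entry n i)); last exact: continuous_entry.
  exact: cvg_fst.
have c2 : (fun y : QZ * nat => y.2.+1%:R^-1 : R) @ (nbhs x, \oo) --> (0 : R).
  apply: (@cvg_comp _ _ _ (@snd QZ nat) (fun k : nat => k.+1%:R^-1 : R)).
    exact: cvg_snd.
  exact: cvg_harmonic.
apply: (@squeeze_cvgr _ _ _ _ (fun y => entry n i y.1 - y.2.+1%:R^-1) (fun y => entry n i y.1)) => //.
  apply: nearW => y. exact: round_down_le.
rewrite -[X in _ --> X]subr0. exact: cvgB.
Qed.

(** The values of [round_down M] are multiples of [1 / M.+1], so [c] may be the
    first multiple after [p], or [q] if that comes first. *)
Lemma round_down_gap M (p q : R) : p < q -> exists c, [/\ p < c, c <= q &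
  forall t, ~~ (p < round_down M t < c)].
Proof.
move=> pq; pose k : int := Num.floor (M.+1%:R * p) + 1.
have M0 : 0 < M.+1%:R :> R by rewrite ltr0n.
exists (Num.min q (k%:~R / M.+1%:R)); split.
- rewrite lt_min pq ltr_pdivlMr// mulrC. exact: Num.Theory.floorD1_gt.
- by rewrite ge_min lexx.
- move=> t; apply/negP => /andP[]; rewrite lt_min => + /andP[_].
  rewrite /round_down ltr_pM2r ?invr_gt0// ltr_int => + tk.
  rewrite ltr_pdivlMr// mulrC => pt.
  have : (Num.floor (M.+1%:R * t)%R <= Num.floor (M.+1%:R * p)).
    by rewrite -ltzD1.
  rewrite -(ler_int R) => tp.
  have := Num.Theory.floor_le (M.+1%:R * p). lra.
Qed.
End Quantize.

(** * Uniformity from compactness *)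

Section Metric.
Variable R : realType.
Local Notation QZ := (biseq (hilbert_cube R)).
Variable d : compatible_metric R QZ.

Lemma cball_nbhs x e : 0 < e -> nbhs x [set y | d x y < e].
Proof. by move=> e0; apply/(cdist_nbhs d); exists e. Qed.

(** A compact set has positive distance to the complement of an open
    neighbourhood. *)
Lemma compact_subset_open (K O : set QZ) : compact K -> open O -> K `<=` O ->
  exists2 e, 0 < e & forall x y, K x -> d x y < e -> O y.
Proof.
move=> cK oO KO.
have /compact_near_coveringP := cK.
move=> /(_ R (0^'+) (fun e x => forall y, d x y < e -> O y) _) [].
  move=> x Kx; have := open_nbhs_nbhs (conj oO (KO x Kx)).
  move=> /(cdist_nbhs d)[e e0 xO].
  exists ([set y | d x y < e / 2], [set r | r < e / 2]).
    split => /=; first by apply: cball_nbhs; lra.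
    by apply: nbhs_right_lt; lra.
  move=> [y r] [/= xy re] z yz; apply: xO.
  have := cdist_triangle d y x z; lra.
move=> e /= e0 H; exists (e / 2); first lra.
move=> x y Kx; apply: (H (e/2)) => //=; last lra.
by rewrite sub0r normrN ger0_norm; lra.
Qed.

(** Although [d] is not given by a formula, compactness makes the local closeness
    of [quantize_cvg] uniform in the point. *)
Lemma quantize_uniform e : 0 < e -> exists M, forall x, d x (quantize M x) < e.
Proof.
move=> e0.
have /compact_near_coveringP := @compact_QZ R.
move=> /(_ nat \oo (fun M x => d x (quantize M x) < e) _) [].
  move=> x _.
  have e20 : 0 < e / 2 by lra.
  have H1 := quantize_cvg (cball_nbhs x e20).
  have H2 : (fst @ (nbhs x, \oo)) [set y | d x y < e / 2] by apply: cvg_fst; exact: cball_nbhs.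
  have near_xy (y : QZ * nat) : d x (quantize y.2 y.1) < e / 2 ->
      d x y.1 < e / 2 -> d y.1 (quantize y.2 y.1) < e.
    have := cdist_triangle d x y.1 (quantize y.2 y.1).
    by rewrite (cdist_sym d y.1 x); lra.
  exact: (@filterS2 _ _ _ _ _ _ near_xy H1 H2).
move=> M _ /(_ M (leqnn M)) H; exists M => x; exact: H.
Qed.
End Metric.

(** * The comeagre set *)

Section Generic.
Variable R : realType.
Local Notation QZ := (biseq (hilbert_cube R)).
Variable d : compatible_metric R QZ.
Implicit Types X Y : subshift_space d.

Definition misses_level (i : nat) (p q : R) : set (subshift_space d) :=
  [set X | exists2 r, p < r < q & forall x, carrier X x -> entry 0 i x != r].

(** A compact [X] missing the level [r] lies in the open set of all sequences that
    miss [r], hence so does a whole metric neighbourhood of [X], which contains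
    every subshift close to [X]. *)
Lemma open_misses_level i p q : open (misses_level i p q).
Proof.
rewrite openE => X [r rpq Xr]; apply/nbhs_ballP.
have [cX X0 _] := carrierP X.
have kX : compact (carrier X).
  exact: (subclosed_compact cX (@compact_QZ R)).
have oO : open [set x : QZ | entry 0 i x != r].
  apply: (@open_comp _ _ (entry 0 i) [set t | t != r]).
    by move=> x _; exact: continuous_entry.
  exact: open_neq.
have [e /= e0 Xe] := compact_subset_open d kX oO Xr.
exists e => //= Y; rewrite -metricType_numDomainType.ball_mdistE /=.
rewrite -[mdist X Y]/(hausdorff_dist d (carrier X) (carrier Y)) hausdorff_dist_sym => XY.
exists r => // y Yy.
have yX := le_lt_trans (dist_set_le_hausdorff d X0 Yy) XY.
have [x Xx xy] : exists2 x, carrier X x & d x y < e.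
  apply: contrapT => noX; move: yX; rewrite ltNge => /negP; apply.
  apply: le_dist_set => // x Xx; rewrite leNgt; apply/negP => yx; apply: noX.
  by exists x => //; rewrite cdist_sym.
exact: Xe Xx xy.
Qed.

Lemma subshifts_quantize M X : subshifts (closure (quantize M @` carrier X)).
Proof.
have [_ [x Xx] /shift_invariantP[Xs Xu]] := carrierP X.
split.
- exact: closed_closure.
- by exists (quantize M x); apply: subset_closure; exists x.
- apply: shift_invariant_closure; apply/shift_invariantP.
  split=> _ [y Xy <-].
    by exists (bishift y) => //; exact: Xs.
  by exists (unshift y) => //; exact: Xu.
Qed.

(** The approximation is the closure of the rounded points of [X]; as rounded
    values avoid a whole subinterval, taking the closure keeps the middle of
    that subinterval missed. *)
Lemma misses_level_dense i p q X e : p < q -> 0 < e ->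
  exists2 Y, misses_level i p q Y & subshift_mdist X Y < e.
Proof.
move=> pq e0; have e40 : 0 < e / 4 by lra.
have [M qM] := quantize_uniform d e40.
pose Y : subshift_space d := exist (fun A => A \in @subshifts R) _ (mem_set (subshifts_quantize M X)).
have YE : carrier Y = closure (quantize M @` carrier X) by [].
have [_ X0 _] := carrierP X; have [_ Y0 _] := carrierP Y.
exists Y.
  have [c [pc cq gap]] := round_down_gap M pq.
  exists ((p + c) / 2); first by lra.
  move=> y; rewrite YE => Yy; apply/eqP => yr.
  have : nbhs y (entry 0 i @^-1` `]p, c[%classic).
    apply: continuous_entry; apply: near_in_itvoo; rewrite -/(entry 0 i y) yr in_itv /=; lra.
  move=> /Yy[_ [[x Xx <-]]] /=; rewrite in_itv entry_quantize.
  exact/negP/gap.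
apply: (@le_lt_trans _ _ (e / 2)); last lra.
apply: hausdorff_dist_le => // [x Xx|y].
  have Yx : carrier Y (quantize M x) by rewrite YE; apply: subset_closure; exists x.
  have := dist_set_le d x Yx; have := qM x; lra.
rewrite YE => /(_ _ (cball_nbhs d y e40))[_ [[x Xx <-] /= yx]].
apply: le_trans (dist_set_le d y Xx) _.
have := cdist_triangle d (quantize M x) y x; have := qM x.
by rewrite (cdist_sym d x); lra.
Qed.

(** The complements of the dense open sets, enumerated through [unpickle]. For
    [p >= q] the interval contains no level that could be missed, and without the
    test the complement would be the whole space. *)
Definition fills_interval (k : nat) : set (subshift_space d) :=
  if unpickle k is Some (i, p, q) then
    if p < q :> rat then ~` misses_level i (ratr p) (ratr q) else set0
  else set0.

Lemma fills_interval_nowhere_dense k : nowhere_dense (fills_interval k).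
Proof.
rewrite /nowhere_dense /fills_interval.
have nd0 : interior (closure (set0 : set (subshift_space d))) = set0.
  by rewrite closure0 interior0.
case: unpickle => [[[i p] q]|//]; case: ifP => // pq.
rewrite -(closure_id _).1; last exact/open_closedC/open_misses_level.
apply/seteqP; split=> // X /nbhs_ballP[e /= e0 XU].
have pqR : ratr p < ratr q :> R by rewrite ltr_rat.
have [Y Yl XY] := misses_level_dense i X pqR e0.
exact: (XU Y).
Qed.

Definition generic : set (subshift_space d) := ~` (\bigcup_k fills_interval k).

Lemma generic_misses X i (p q : rat) : generic X -> p < q ->
  misses_level i (ratr p) (ratr q) X.
Proof.
move=> GX pq; apply: contrapT => nX; apply: GX; exists (pickle (i, p, q)) => //.
by rewrite /fills_interval pickleK pq.
Qed.

End Generic.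

(** * The embedding *)

Section Embedding.
Variable R : realType.
Local Notation QZ := (biseq (hilbert_cube R)).
Variable d : compatible_metric R QZ.

Lemma entry_neq2 n i (x : QZ) : entry n i x != 2.
Proof. by apply/eqP => x2; have := entry01 n i x; rewrite x2; lra. Qed.

(** A countable family of levels, each missed by the coordinate it is meant for,
    and dense among the levels of each coordinate. *)
Definition cutting_levels (X : set QZ) (cut : nat -> nat * R) : Prop :=
  (forall k x, X x -> entry 0 (cut k).1 x != (cut k).2) /\
  (forall i p q, p < q -> exists k, (cut k).1 = i /\ p < (cut k).2 < q).

Lemma generic_cutting_levels (X : subshift_space d) :
  generic X -> exists cut, cutting_levels (carrier X) cut.
Proof.
move=> GX.
have : forall k : nat, exists c : nat * R,
    (forall x, carrier X x -> entry 0 c.1 x != c.2) /\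
    (forall i (p q : rat), unpickle k = Some (i, p, q) -> p < q ->
       c.1 = i /\ ratr p < c.2 < ratr q).
  move=> k; case: unpickle => [[[i p] q]|]; last first.
    (* The level 2 is missed by every entry: a harmless default. *)
    by exists (0, 2); split=> // x _; exact: entry_neq2.
  have [pq|qp] := ltP p q.
    have [r rpq Xr] := generic_misses i GX pq.
    by exists (i, r); split=> // _ _ _ [<- <- <-].
  exists (0, 2); split=> [x _|i' p' q' [_ <- <-]]; first exact: entry_neq2.
  by rewrite ltNge qp.
move=> /choice[cut cutP]; exists cut; split=> [k|i p q pq].
  exact: (cutP k).1.
have [a] := rat_in_itvoo pq; rewrite in_itv /= => /andP[pa aq].
have [b] := rat_in_itvoo aq; rewrite in_itv /= => /andP[ab bq].
have ab' : a < b by rewrite ltr_rat in ab.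
have [ci] := (cutP (pickle (i, a, b))).2 i a b (pickleK _) ab'.
by exists (pickle (i, a, b)); split=> //; lra.
Qed.

Definition below_cuts (cut : nat -> nat * R) (n : int) (x : QZ) (k : nat) : bool :=
  entry n (cut k).1 x < (cut k).2.

Lemma ternary_unit (b : nat -> bool) : ternary R b \in `[0, 1]%classic.
Proof. by apply/mem_set; rewrite /= in_itv ternary01. Qed.

Definition cut_code (cut : nat -> nat * R) (m : nat) (x : QZ) :
    biseq (cube R m) :=
  fun n j => exist (fun t => t \in `[0, 1]%classic) _ (ternary_unit (below_cuts cut n x)).

(** Near a point of [X] the entries stay on the same side of a missed level, so
    each bit is locally constant and the code is continuous on [X] although it is
    not on the full shift. *)
Lemma cut_code_embedding (X : subshift_space d) cut m : (0 < m)%N ->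
  cutting_levels (carrier X) cut ->
  embedding (@restr_shift R d X) (@bishift R (cube R m))
    (fun x : carrier X => @cut_code cut m (set_val x)).
Proof.
move=> m0 [Xcut cutd]; split.
- move=> x.
  apply: (cvg_cube_biseq (nbhs_filter x)) => n j.
  apply: cvg_ternary => k.
  have xk : entry n (cut k).1 (set_val x) != (cut k).2.
    have [y Xy ->] := shift_invariant_entry (carrier_shift_invariant X) n (set_mem (valP x)).
    exact: Xcut.
  have ce : (entry n (cut k).1 (set_val t)) @[t --> x] --> entry n (cut k).1 (set_val x).
    apply: (@continuous_comp _ _ _ (set_val : carrier X -> QZ) (entry n (cut k).1)).
      exact: initial_continuous.
    exact: continuous_entry.
  rewrite /below_cuts; case: ltgtP xk => // xk _.
    by apply: filterS (cvgr_lt _ ce _ xk) => t.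
  apply: filterS (cvgr_gt _ ce _ xk) => t tk.
  by apply/negbTE; rewrite -leNgt ltW.
- move=> x y xy; apply/val_inj/entry_ext => n i.
  have digits : below_cuts cut n (set_val x) =1 below_cuts cut n (set_val y).
    apply: (@ternary_inj R).
    exact: (congr1 (fun z : biseq (cube R m) => set_val (z n (Ordinal m0))) xy).
  have [/(cutd i)|/(cutd i)|//] := ltgtP (entry n i (set_val x)) (entry n i (set_val y));
    move=> [k [ki /andP[lo hi]]]; have := digits k;
    by rewrite /below_cuts ki lo ltNge (ltW hi).
- move=> x; rewrite restr_shiftE; apply/funext => n; apply/funext => j.
  by apply: val_inj.
Qed.

End Embedding.

Theorem mainTheorem6 (R : realType)
    (d : compatible_metric R (biseq (hilbert_cube R))) :
  exists2 G : set (subshift_space d), comeagre G &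
    forall X : subshift_space d, G X ->
    forall m : nat, (0 < m)%N ->
      (mdim (@restr_dist R d X) (@restr_shift R d X) < (m%:R / 2)%:E)%E ->
      (forall n : nat, (0 < n)%N ->
         (covdim R (set_type (periodic_points (@restr_shift R d X) n))
            / (n%:R)%:E < (m%:R / 2)%:E)%E) ->
      exists f : carrier X -> biseq (cube R m),
        embedding (@restr_shift R d X) (@bishift R (cube R m)) f.
Proof.
exists (generic (d := d)).
  by exists (@fills_interval R d) => //; exact: fills_interval_nowhere_dense.
move=> X /generic_cutting_levels[cut cutX] m m0 _ _.
by exists (fun x => @cut_code R cut m (set_val x)); exact: cut_code_embedding.
Qed.
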